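(* Let $\alpha>0$, let $\mathbf{A}_{11}\in\mathbb{R}^{n_1\times n_1}$ be stable, and let $\mathbf{A}(\alpha),\mathbf{H}(\alpha),\mathbf{N},\mathbf{B}$ be the matrices of an artificially stabilized lifted quadratic-bilinear system, with block structure $$\mathbf{A}(\alpha)=\begin{bmatrix}\mathbf{A}_{11}&\mathbf{A}_{12}\\ \mathbf{0}&-\alpha\mathbf{I}\end{bmatrix},\quad \mathbf{H}(\alpha)=\begin{bmatrix}\mathbf{0}\\ \mathbf{H}_2(\alpha)\end{bmatrix},\quad \mathbf{N}=\begin{bmatrix}\mathbf{0}&\mathbf{0}\\ \mathbf{N}_{21}&\mathbf{N}_{22}\end{bmatrix},\quad \mathbf{B}=\begin{bmatrix}\mathbf{B}_1\\ \mathbf{0}\end{bmatrix},$$ and let $\mathbf{H}_{21}(\alpha)\in\mathbb{R}^{n_2\times n_1^2}$ be the submatrix of $\mathbf{H}_2(\alpha)$ acting on $\mathbf{x}_1\otimes\mathbf{x}_1$ (see context). Let $$\mathbf{P}_1=\begin{bmatrix}\mathbf{P}_{11}&\mathbf{0}\\ \mathbf{0}&\mathbf{0}\end{bmatrix},\qquad \mathbf{A}_{11}\mathbf{P}_{11}+\mathbf{P}_{11}\mathbf{A}_{11}^\top+\mathbf{B}_1\mathbf{B}_1^\top=\mathbf{0},$$ which is the solution of $\mathbf{A}(\alpha)\mathbf{P}_1+\mathbf{P}_1\mathbf{A}(\alpha)^\top+\mathbf{B}\mathbf{B}^\top=\mathbf{0}$. Then the truncated (controllability) Gramian $\mathbf{P}_{\mathcal{T}}$,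 i.e. the solution of $$\mathbf{A}(\alpha)\mathbf{P}_{\mathcal{T}}+\mathbf{P}_{\mathcal{T}}\mathbf{A}(\alpha)^\top+\mathbf{H}(\alpha)(\mathbf{P}_1\otimes\mathbf{P}_1)\mathbf{H}(\alpha)^\top+\mathbf{N}\mathbf{P}_1\mathbf{N}^\top+\mathbf{B}\mathbf{B}^\top=\mathbf{0},$$ is given by $$\mathbf{P}_{\mathcal{T}}=\mathbf{P}_1+\frac{1}{2\alpha}\begin{bmatrix}\widetilde{\mathbf{P}}_{11}(\alpha)&\widetilde{\mathbf{P}}_{12}(\alpha)\\ \widetilde{\mathbf{P}}_{12}(\alpha)^\top&\widetilde{\mathbf{P}}_{22}(\alpha)\end{bmatrix},$$ where $$\widetilde{\mathbf{P}}_{22}(\alpha)=\mathbf{H}_{21}(\alpha)(\mathbf{P}_{11}\otimes\mathbf{P}_{11})\mathbf{H}_{21}(\alpha)^\top+\mathbf{N}_{21}\mathbf{P}_{11}\mathbf{N}_{21}^\top,$$ $$\widetilde{\mathbf{P}}_{12}(\alpha)=-(\mathbf{A}_{11}-\alpha\mathbf{I})^{-1}\mathbf{A}_{12}\widetilde{\mathbf{P}}_{22}(\alpha),$$ and $\widetilde{\mathbf{P}}_{11}(\alpha)$ is the solution of $$\mathbf{A}_{11}\widetilde{\mathbf{P}}_{11}(\alpha)+\widetilde{\mathbf{P}}_{11}(\alpha)\mathbf{A}_{11}^\top+\mathbf{A}_{12}\widetilde{\mathbf{P}}_{12}(\alpha)^\top+\widetilde{\mathbf{P}}_{12}(\alp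ha)\mathbf{A}_{12}^\top=\mathbf{0}.$$
   Context: A real square matrix is called stable if all its eigenvalues have strictly negative real part; for a stable coefficient matrix the Lyapunov equations involved have unique solutions. $\otimes$ is the Kronecker product and $\mathbf{I}$ an identity matrix of appropriate size. Lifted quadratic-bilinear system: the state is $\mathbf{x}=[\mathbf{x}_1^\top,\mathbf{w}^\top]^\top\in\mathbb{R}^{n_1+n_2}$, where $\mathbf{x}_1\in\mathbb{R}^{n_1}$ is the original state and $\mathbf{w}\in\mathbb{R}^{n_2}$ collects the auxiliary (lifting) variables, given by a map $\mathbf{w}=\tau(\mathbf{x}_1)$. With $N=n_1+n_2$, the lifted dynamics have a linear term with matrix $\begin{bmatrix}\mathbf{A}_{11}&\mathbf{A}_{12}\\ \mathbf{0}&\mathbf{0}\end{bmatrix}$, a quadratic term $\mathbf{H}(\mathbf{x}\otimes\mathbf{x})$ with $\mathbf{H}=\begin{bmatrix}\mathbf{0}\\ \mathbf{H}_2\end{bmatrix}\in\mathbb{R}^{N\times N^2}$ (first $n_1$ rows zero), a bilinear term with matrix $\mathbf{N}\in\mathbb{R}^{N\times N}$, and an input term with matrix $\mathbf{B}\in\mathbb{R}^{N\times m}$ ($\mathbf{N}_{21}\in\mathbb{R}^{n_2\times n_1}$, $\mathbf{N}_{22}\in\mathbb{R}^{n_2\times n_2}$, $\mathbf{A}_{12}\in\mathbb{R}^{n_1\times n_2}$, $\mathbf{B}_1\in\mathbb{R}^{n_1\times m}$). The artificial stabilization replaces the linear matrix by $\mathbf{A}(\alpha)$ and $\mathbf{H}$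 by $\mathbf{H}(\alpha)=\mathbf{H}+\widetilde{\mathbf{H}}(\alpha)$, where $\widetilde{\mathbf{H}}(\alpha)\in\mathbb{R}^{N\times N^2}$ has its first $n_1$ rows zero and satisfies $-\alpha[\mathbf{0}^\top,\mathbf{w}^\top]^\top+\widetilde{\mathbf{H}}(\alpha)(\mathbf{x}\otimes\mathbf{x})=\mathbf{0}$ for all lifted states $\mathbf{x}=[\mathbf{x}_1^\top,\mathbf{w}^\top]^\top$ with $\mathbf{w}=\tau(\mathbf{x}_1)$. Thus $\mathbf{H}(\alpha)$ also has its first $n_1$ rows zero, and $\mathbf{H}_2(\alpha)\in\mathbb{R}^{n_2\times N^2}$ denotes its last $n_2$ rows. $\mathbf{H}_{21}(\alpha)\in\mathbb{R}^{n_2\times n_1^2}$ is the submatrix of $\mathbf{H}_2(\alpha)$ consisting of the $n_1^2$ columns multiplying the entries of $\mathbf{x}_1\otimes\mathbf{x}_1$ in $\mathbf{x}\otimes\mathbf{x}$ (in the order of $\mathbf{x}_1\otimes\mathbf{x}_1$); equivalently $\mathbf{H}_{21}(\alpha)=\mathbf{H}_2(\alpha)(\mathbf{E}\otimes\mathbf{E})$ with $\mathbf{E}=\begin{bmatrix}\mathbf{I}\\ \mathbf{0}\end{bmatrix}\in\mathbb{R}^{N\times n_1}$. *)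

(* Defs.v *)
From mathcomp Require Import all_boot all_order all_algebra.
From mathcomp Require Import reals complex mxtens.
Set Implicit Arguments.
Unset Strict Implicit.
Unset Printing Implicit Defensive.
Import GRing.Theory Num.Theory.
Local Open Scope ring_scope.

(* The Kronecker product is [_ *t _] from mxtens; the pair of indices (i, j) is
   encoded there in row-major order, so x *t y stacks the blocks x_i *: y. *)

Section Defs.
Variable R : realType.

(* [eigenvalue] refers to left eigenvectors; the eigenvalues are the same. *)
Definition stable n (A : 'M[R]_n) : Prop :=
  forall z : R[i], eigenvalue (map_mx (real_complex R) A) z -> complex.Re z < 0.

Definition lyapunov n (A Q P : 'M[R]_n) : Prop :=
  A *m P + P *m A^T + Q = 0.

(* P1 is meant to solve [lyapunov A (B *m B^T)]. *)
Definition truncated_gramian_eq n m (A : 'M[R]_n) (H : 'M[R]_(n, n * n))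
    (N : 'M[R]_n) (B : 'M[R]_(n, m)) (P1 PT : 'M[R]_n) : Prop :=
  A *m PT + PT *m A^T + H *m (P1 *t P1) *m H^T + N *m P1 *m N^T + B *m B^T = 0.

(* The terms added by the artificial stabilization cancel at every lifted state. *)
Definition stabilizing_term n1 n2 (tau : 'cV[R]_n1 -> 'cV[R]_n2) (alpha : R)
    (Ht : 'M[R]_(n1 + n2, (n1 + n2) * (n1 + n2))) : Prop :=
  forall x1 : 'cV[R]_n1,
    let x := col_mx x1 (tau x1) in
    - (alpha *: col_mx 0 (tau x1)) + Ht *m (x *t x) = 0.

(* Position, in x *t x with x = col_mx x1 w, of the k-th entry of x1 *t x1. *)
Definition x1x1_index n1 n2 (k : 'I_(n1 * n1)) : 'I_((n1 + n2) * (n1 + n2)) :=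
  let ij := mxtens_unindex k in
  mxtens_index (lshift n2 ij.1, lshift n2 ij.2).

Definition x1x1_columns n1 n2 p (M : 'M[R]_(p, (n1 + n2) * (n1 + n2))) :
    'M[R]_(p, n1 * n1) :=
  colsub (@x1x1_index n1 n2) M.

Lemma x1x1_columnsE n1 n2 p (M : 'M[R]_(p, (n1 + n2) * (n1 + n2))) :
  let E : 'M[R]_(n1 + n2, n1) := col_mx 1%:M 0 in
  x1x1_columns M = M *m (E *t E).
Proof.
move=> E; apply/matrixP => i k.
case: (mxtens_indexP k) => a b.
rewrite !mxE /x1x1_index mxtens_indexK /=.
have EE (c : 'I_(n1 + n2)) d : E c d = (c == lshift n2 d)%:R.
  rewrite /E; case: (split_ordP c) => c' ->.
    by rewrite col_mxEu mxE eq_lshift.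
  by rewrite col_mxEd mxE eq_rlshift.
rewrite (bigD1 (mxtens_index (lshift n2 a, lshift n2 b))) //=.
rewrite tensmxE !EE !eqxx !mulr1 big1 ?addr0 // => l.
case: (mxtens_indexP l) => c d; rewrite tensmxE !EE => ne.
have [ca | _] := eqVneq c (lshift n2 a); last by rewrite mul0r mulr0.
have [db | _] := eqVneq d (lshift n2 b); last by rewrite !mulr0.
by rewrite ca db eqxx in ne.
Qed.

End Defs.

(* Main.v *)
(* For a stable A, the matrices A and - A^T have disjoint spectra, so that an
   intertwiner A P = - P A^T satisfies 0 = chi_A(A) P = P chi_A(- A^T) with
   chi_A(- A^T) invertible, and P = 0. Hence every Lyapunov equation for A has
   exactly one solution. The block triangular matrix A(alpha) is stable too, so
   it suffices to check that the proposed matrices solve their equations, block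
   by block: the quadratic and bilinear terms only contribute to the lower right
   block. The lower left block additionally needs P11, hence Pt22, to be
   symmetric, which follows from uniqueness. *)

Require Import Defs.
From mathcomp Require Import all_boot all_order all_algebra.
From mathcomp Require Import reals complex mxtens.
Set Implicit Arguments.
Unset Strict Implicit.
Unset Printing Implicit Defensive.
Import GRing.Theory Num.Theory.
Local Open Scope ring_scope.

Lemma eigenvalue_notin_unitmx (F : fieldType) n (A : 'M[F]_n) (a : F) :
  eigenvalue A a = (A - a%:M \notin unitmx).
Proof. by rewrite /eigenvalue /eigenspace kermx_eq0 row_free_unit. Qed.

Lemma horner_mx_intertwine (R : comNzRingType) m n (A : 'M[R]_m.+1)
    (B : 'M[R]_n.+1) (X : 'M[R]_(m.+1, n.+1)) (p : {poly R}) :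
  A *m X = X *m B -> horner_mx A p *m X = X *m horner_mx B p.
Proof.
move=> AX; elim/poly_ind: p => [|p c IHp].
  by rewrite !rmorph0 mul0mx mulmx0.
rewrite !rmorphD !rmorphM /= !horner_mx_X !horner_mx_C mulmxDl mulmxDr.
by rewrite -mulmxA AX mulmxA IHp -mulmxA scalar_mxC.
Qed.

(** By Cayley-Hamilton, the characteristic polynomial of [A] evaluated at [B] is annihilated by [X]
    on the left. Over a closed field it splits into factors [B - z%:M] with [z] an eigenvalue of
    [A], each invertible because [z] is not an eigenvalue of [B]. *)
Lemma sylvester_kernel (F : closedFieldType) m n (A : 'M[F]_m) (B : 'M[F]_n)
    (X : 'M[F]_(m, n)) :
    (forall a, eigenvalue A a -> ~~ eigenvalue B a) -> A *m X = X *m B ->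
  X = 0.
Proof.
(* [horner_mx] lives in the ring of matrices of nonzero size, so empty dimensions are treated
   apart. *)
case: m => [|m] in A X *; first by rewrite flatmx0 => *; apply: flatmx0.
case: n => [|n] in B X *; first by rewrite thinmx0 => *; apply: thinmx0.
move=> AB /(horner_mx_intertwine (char_poly A)).
rewrite Cayley_Hamilton mul0mx.
have [r pE] := closed_field_poly_normal (char_poly A).
have rA z : z \in r -> eigenvalue A z.
  move=> zr; rewrite eigenvalue_root_char pE rootZ ?root_prod_XsubC //.
  by rewrite (monicP (char_poly_monic A)) oner_eq0.
rewrite {}pE (monicP (char_poly_monic A)) scale1r rmorph_prod /= => /esym.
set U := \prod_(z <- r) _; suff uU : U \in unitmx.
  by move/(congr1 (mulmxr (invmx U))); rewrite /= mulmxK // mul0mx.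
rewrite /U big_seq; elim/big_ind: _ => [|M N uM uN|z zr]; first exact: unitmx1.
  by rewrite unitmx_mul uM.
rewrite rmorphB /= horner_mx_X horner_mx_C.
by have := AB z (rA z zr); rewrite eigenvalue_notin_unitmx negbK.
Qed.

(** A real eigenvalue [a] would also be an eigenvalue of the complexified matrix, with nonnegative
    real part. This makes the inverse in [Pt12] meaningful. *)
Lemma stable_sub_scalar_unitmx (R : realType) n (A : 'M[R]_n) (a : R) :
  stable A -> 0 <= a -> A - a%:M \in unitmx.
Proof.
move=> sA a_ge0; apply: contraT; rewrite -eigenvalue_notin_unitmx.
rewrite -(eigenvalue_map (real_complex R)) => /sA /=.
by rewrite Order.TotalTheory.ltNge a_ge0.
Qed.

Lemma eigenvalue_trmx (F : fieldType) n (A : 'M[F]_n) :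
  eigenvalue A^T =1 eigenvalue A.
Proof.
move=> a; rewrite !eigenvalue_notin_unitmx -[in RHS]unitmx_tr.
by rewrite linearB /= tr_scalar_mx.
Qed.

Lemma eigenvalue_oppmx (F : fieldType) n (A : 'M[F]_n) (a : F) :
  eigenvalue (- A) a = eigenvalue A (- a).
Proof.
apply/eigenvalueP/eigenvalueP => -[v vA v0]; exists v => //.
  by rewrite scaleNr -vA mulmxN opprK.
by rewrite mulmxN vA scaleNr opprK.
Qed.

Lemma stable_scalar_mx (R : realType) n (a : R) :
  a < 0 -> stable (a%:M : 'M[R]_n).
Proof.
move=> a_lt0 z; rewrite map_scalar_mx => /eigenvalueP[v].
rewrite mul_mx_scalar => /eqP; rewrite -subr_eq0 -scalerBl scaler_eq0 subr_eq0.
by move=> /orP[/eqP<- //|->].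
Qed.

(** The determinant of a block triangular matrix is the product of those of its diagonal blocks, so
    each eigenvalue comes from one of them. *)
Lemma stable_ublock (R : realType) n1 n2 (A11 : 'M[R]_n1) (A12 : 'M[R]_(n1, n2))
    (A22 : 'M[R]_n2) :
  stable A11 -> stable A22 -> stable (block_mx A11 A12 0 A22).
Proof.
move=> s1 s2 z; rewrite eigenvalue_notin_unitmx map_block_mx map_mx0.
rewrite scalar_mx_block opp_block_mx add_block_mx !oppr0 !addr0.
rewrite unitmxE det_ublock unitrM -!unitmxE negb_and.
by rewrite -!eigenvalue_notin_unitmx => /orP[/s1|/s2].
Qed.

(** After complexification, the eigenvalues of [A] have negative real part and those of [- A^T]
    positive real part. *)
Lemma lyapunov_kernel (R : realType) n (A P : 'M[R]_n) :
  stable A -> A *m P + P *m A^T = 0 -> P = 0.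
Proof.
move=> sA /eqP; rewrite addr_eq0 -mulmxN => /eqP.
move/(congr1 (map_mx (real_complex R))); rewrite !map_mxM map_mxN /= => AP.
apply: (map_mx_inj (f := real_complex R)); rewrite map_mx0.
apply: sylvester_kernel AP => a /sA Re_a.
rewrite eigenvalue_oppmx -map_trmx eigenvalue_trmx; apply/negP => /sA.
rewrite raddfN /= oppr_lt0 Order.TotalTheory.ltNge.
by rewrite (Order.POrderTheory.ltW Re_a).
Qed.

Lemma lyapunov_unique (R : realType) n (A Q P : 'M[R]_n) :
  stable A -> lyapunov A Q P -> unique (lyapunov A Q) P.
Proof.
move=> sA PQ; split=> // P' P'Q; apply/subr0_eq/(lyapunov_kernel sA).
rewrite mulmxBr mulmxBl addrACA -opprD.
move: PQ P'Q; rewrite /lyapunov => /addr0_eq <- /addr0_eq /oppr_inj ->.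
by rewrite subrr.
Qed.

(** The operator [L] is an injective endomorphism of a finite-dimensional space, hence invertible;
    its matrix acts on vectorized matrices. *)
Lemma lyapunov_exists_unique (R : realType) n (A Q : 'M[R]_n) :
  stable A -> exists! P, lyapunov A Q P.
Proof.
move=> sA; pose L := mulmx A \+ mulmxr A^T.
have L_free : row_free (lin_mx L).
  apply: inj_row_free => v; rewrite mul_rV_lin => /(congr1 vec_mx).
  rewrite mxvecK linear0 => /(lyapunov_kernel sA) /(congr1 mxvec).
  by rewrite vec_mxK linear0.
pose P := vec_mx (mxvec (- Q) *m invmx (lin_mx L)).
exists P; apply: lyapunov_unique => //; rewrite /lyapunov.
suff /eqP: L P = - Q by rewrite -addr_eq0 => /eqP.
apply: etrans (esym (mx_vec_lin L P)) _.
by rewrite vec_mxK mulmxKV ?mxvecK // -row_free_unit.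
Qed.

(** Transposing the equation shows that [P^T] solves it too. *)
Lemma lyapunov_sym (R : realType) n (A Q P : 'M[R]_n) :
  stable A -> Q^T = Q -> lyapunov A Q P -> P^T = P.
Proof.
move=> sA QT PQ; apply/esym; have [_] := lyapunov_unique sA PQ; apply.
move/(congr1 trmx): PQ; rewrite /lyapunov !linearD /= !trmx_mul trmxK QT trmx0.
by rewrite [X in X + _]addrC.
Qed.

(** Since [P1 = E *m P *m E^T], this is the mixed-product rule. It lets [E *t E] be absorbed into
    [H2], which produces [H21]. *)
Lemma tens_ulblock_mx (R : comPzRingType) n1 n2 (P : 'M[R]_n1) :
  let E : 'M[R]_(n1 + n2, n1) := col_mx 1%:M 0 in
  let P1 : 'M[R]_(n1 + n2) := block_mx P 0 0 0 in
  P1 *t P1 = (E *t E) *m (P *t P) *m (E *t E)^T.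
Proof.
move=> E P1; suff -> : P1 = E *m P *m E^T by rewrite trmx_tens !tensmx_mul.
rewrite /E tr_col_mx trmx1 trmx0 mul_col_mx mul1mx mul0mx mul_col_row.
by rewrite mulmx1 mulmx0 !mul0mx.
Qed.

Lemma quadratic_term_block (R : realType) n1 n2
    (H2 : 'M[R]_(n2, (n1 + n2) * (n1 + n2))) (P : 'M[R]_n1) :
  let H : 'M[R]_(n1 + n2, (n1 + n2) * (n1 + n2)) := col_mx 0 H2 in
  let P1 : 'M[R]_(n1 + n2) := block_mx P 0 0 0 in
  let H21 := x1x1_columns H2 in
  H *m (P1 *t P1) *m H^T = block_mx 0 0 0 (H21 *m (P *t P) *m H21^T).
Proof.
move=> H P1 H21; rewrite /P1 tens_ulblock_mx /H21 x1x1_columnsE /=.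
set E := (_ *t _ : 'M_(_, n1 * n1)); rewrite !mulmxA -!(mulmxA _ E^T) -trmx_mul.
rewrite /H mul_col_mx mul0mx mul_col_mx mul0mx tr_col_mx trmx0 mul_col_row.
by rewrite !mulmx0 mul0mx.
Qed.

Theorem proposition4 (R : realType) (n1 n2 m : nat)
    (A11 : 'M[R]_n1) (A12 : 'M[R]_(n1, n2))
    (H2 : 'M[R]_(n2, (n1 + n2) * (n1 + n2)))
    (N21 : 'M[R]_(n2, n1)) (N22 : 'M[R]_n2) (B1 : 'M[R]_(n1, m))
    (tau : 'cV[R]_n1 -> 'cV[R]_n2)
    (alpha : R) (Ht2 : 'M[R]_(n2, (n1 + n2) * (n1 + n2))) :
  let A : 'M[R]_(n1 + n2) := block_mx A11 A12 0 (- alpha)%:M in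
  let H : 'M[R]_(n1 + n2, (n1 + n2) * (n1 + n2)) := col_mx 0 H2 in
  let Ht : 'M[R]_(n1 + n2, (n1 + n2) * (n1 + n2)) := col_mx 0 Ht2 in
  let Ha := H + Ht in
  let N : 'M[R]_(n1 + n2) := block_mx 0 0 N21 N22 in
  let B : 'M[R]_(n1 + n2, m) := col_mx B1 0 in
  let H21 : 'M[R]_(n2, n1 * n1) := x1x1_columns (dsubmx Ha) in
  0 < alpha ->
  stable A11 ->
  stabilizing_term tau alpha Ht ->
  A11 - alpha%:M \in unitmx /\
  (exists! P11, lyapunov A11 (B1 *m B1^T) P11) /\
  (forall P11 : 'M[R]_n1, lyapunov A11 (B1 *m B1^T) P11 ->
    let P1 : 'M[R]_(n1 + n2) := block_mx P11 0 0 0 in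
    let Pt22 : 'M[R]_n2 :=
      H21 *m (P11 *t P11) *m H21^T + N21 *m P11 *m N21^T in
    let Pt12 : 'M[R]_(n1, n2) :=
      - (invmx (A11 - alpha%:M) *m A12 *m Pt22) in
    let Q := A12 *m Pt12^T + Pt12 *m A12^T in
    unique (lyapunov A (B *m B^T)) P1 /\
    (exists! Pt11, lyapunov A11 Q Pt11) /\
    (forall Pt11 : 'M[R]_n1, lyapunov A11 Q Pt11 ->
      unique (truncated_gramian_eq A Ha N B P1)
        (P1 + (2 * alpha)^-1 *: block_mx Pt11 Pt12 Pt12^T Pt22))).
Proof.
move=> A H Ht Ha N B H21 alpha_gt0 sA11 _.
have sA : stable A.
  by apply: stable_ublock => //; apply: stable_scalar_mx; rewrite oppr_lt0.
have uA11 : A11 - alpha%:M \in unitmx.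
  exact: stable_sub_scalar_unitmx sA11 (Order.POrderTheory.ltW alpha_gt0).
split=> //; split; first exact: lyapunov_exists_unique.
move=> P11 P11_eq P1 Pt22 Pt12 Q.
have P11T : P11^T = P11.
  by apply: lyapunov_sym sA11 _ P11_eq; rewrite trmx_mul trmxK.
have Pt22T : Pt22^T = Pt22.
  by rewrite linearD /= !trmx_mul !trmxK trmx_tens P11T !mulmxA.
have BBT : B *m B^T = block_mx (B1 *m B1^T) 0 0 0.
  by rewrite tr_col_mx trmx0 mul_col_row !mul0mx !mulmx0.
have AT : A^T = block_mx A11^T 0 A12^T (- alpha)%:M.
  by rewrite tr_block_mx trmx0 tr_scalar_mx.
have P1_eq : lyapunov A (B *m B^T) P1.
  rewrite /lyapunov BBT AT !mulmx_block !(mulmx0, mul0mx, addr0, add0r).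
  by rewrite !add_block_mx !addr0 P11_eq block_mx0.
split; first exact: lyapunov_unique.
split=> [|Pt11 Pt11_eq]; first exact: lyapunov_exists_unique.
have QHN : Ha *m (P1 *t P1) *m Ha^T + N *m P1 *m N^T = block_mx 0 0 0 Pt22.
  have HaE : Ha = col_mx 0 (H2 + Ht2) by rewrite /Ha add_col_mx addr0.
  rewrite /Pt22 /H21 HaE quadratic_term_block col_mxKd tr_block_mx !trmx0.
  rewrite !mulmx_block !(mulmx0, mul0mx, addr0, add0r) add_block_mx.
  by rewrite !addr0.
set S := block_mx Pt11 Pt12 Pt12^T Pt22.
(* This is the upper right block of the equation for [S]; solving it for [Pt12] gives the formula
   with the inverse. *)
have Pt12_eq : A11 *m Pt12 + A12 *m Pt22 - alpha *: Pt12 = 0.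
  rewrite addrAC -mul_scalar_mx -mulmxBl mulmxN -mulmxA mulKVmx //.
  by rewrite addNr.
(* The factor [2 * alpha] arises in the lower right block, where both products contribute
   [- alpha *: Pt22]. *)
have S_eq : A *m S + S *m A^T = - (2 * alpha) *: block_mx 0 0 0 Pt22.
  rewrite AT !mulmx_block !(mulmx0, mul0mx, addr0, add0r) add_block_mx.
  rewrite !mul_scalar_mx !mul_mx_scalar scale_block_mx !scaler0.
  congr block_mx.
  - by rewrite addrACA.
  - by rewrite scaleNr.
  (* The lower left block is the transpose of [Pt12_eq], by symmetry of [Pt22]. *)
  - clearbody Pt12 Pt22; move/(congr1 trmx): Pt12_eq.
    rewrite !linearD /= linearN /= linearZ /=.
    by rewrite !trmx_mul Pt22T trmx0 scaleNr addrC.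
  - by rewrite -scalerDl -opprD mulr2n mulrDl mul1r.
(* With [P1] fixed, the quadratic and bilinear terms are constants, so the equation is a Lyapunov
   equation in [P]. *)
have PT_lyap P : truncated_gramian_eq A Ha N B P1 P <->
    lyapunov A (block_mx 0 0 0 Pt22 + B *m B^T) P.
  by rewrite /lyapunov -QHN /truncated_gramian_eq !addrA.
have [|PT_eq PT_uniq] := @lyapunov_unique _ _ A
  (block_mx 0 0 0 Pt22 + B *m B^T) (P1 + (2 * alpha)^-1 *: S) sA.
  (* By linearity, [P1] accounts for [B *m B^T] and the scaled [S] for the block [Pt22]. *)
  rewrite /lyapunov mulmxDr mulmxDl [X in X + _]addrACA.
  rewrite -scalemxAr -scalemxAl -scalerDr S_eq scaleNr scalerN scalerA.
  rewrite mulVf ?scale1r; last first.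
    by rewrite mulf_neq0 ?pnatr_eq0 ?lt0r_neq0.
  by rewrite addrA subrK.
by split=> [|P /PT_lyap]; [apply/PT_lyap | exact: PT_uniq].
Qed.
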